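(* For every $c>0$, there exist a prime power $q$ and a non-standard primitive action of $\mathrm{P\Gamma L}_2(q)$ on a set $\Omega$ such that $\mathrm{B}(\mathrm{P\Gamma L}_2(q),\Omega)>c$.
   Context: Let $G$ act on a set $\Omega$. A finite sequence $\Lambda$ of points of $\Omega$ is a base if its pointwise stabilizer in $G$ is trivial, and is a minimal base if it is a base and no proper subsequence of it is a base. $\mathrm{B}(G,\Omega)$ is the maximum size of a minimal base. A standard action of an almost simple group $G$ with socle $S$ is a transitive action where either $S=A_n$ and the action is on subsets or uniform partitions of $\{1,\dots,n\}$, or $G$ is classical and the action is a subspace action. An action is non-standard if it is not standard. Here (following Burness) a subspace action of a classical group with socle $S$ and natural module $V$ is a primitive action with point stabilizer $H$ such that every maximal subgroup of $S$ containing $H\cap S$ either acts reducibly on $V$, or is an orthogonal group $O^{\pm}_{2m}(q)$ in $S=Sp_{2m}(q)'$ with $q$ even. *)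

(* Defs.v *)
From HB Require Import structures.
From mathcomp Require Import all_boot all_order all_fingroup all_algebra all_solvable.
From mathcomp Require Import boolp reals.

Set Implicit Arguments.
Unset Strict Implicit.
Unset Printing Implicit Defensive.

Import GRing.Theory.

Local Open Scope ring_scope.
Local Open Scope group_scope.

Section Bases.

Variables (aT : finGroupType) (G : {group aT}).
Variables (Omega : finType) (to : {action aT &-> Omega}).

Definition is_base (s : seq Omega) : Prop :=
  'C_G([set x in s] | to) = 1.

Definition minimal_base (s : seq Omega) : Prop :=
  is_base s /\ forall t, subseq t s -> t <> s -> ~ is_base t.

Lemma minimal_base_size s : minimal_base s -> (size s <= #|Omega|)%N.
Proof.
move=> [bs ms]; have us : uniq s; last by rewrite -(card_uniqP us) max_card.
apply: contraT => nus; have ne : undup s <> s.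
  by move=> e; move: nus; rewrite -e undup_uniq.
case: (ms _ (undup_subseq s) ne); rewrite /is_base -bs; congr ('C_G(_ | to)).
by apply/setP=> x; rewrite !inE mem_undup.
Qed.

(* The maximum size of a minimal base; by [minimal_base_size] the bound on k
   excludes none. It is 0 if there is no base, i.e. if G is not faithful. *)
Definition max_minimal_base : nat :=
  \max_(k < #|Omega|.+1 | `[< exists s, minimal_base s /\ size s = k >]) k.

Lemma leq_max_minimal_base s :
  minimal_base s -> (size s <= max_minimal_base)%N.
Proof.
move=> ms; have lt_s : (size s < #|Omega|.+1)%N by rewrite ltnS minimal_base_size.
rewrite /max_minimal_base; pose k := Ordinal lt_s.
by rewrite (bigmax_sup k) //; apply/asboolP; exists s.
Qed.

End Bases.

Section AlmostSimple.

Variables (aT : finGroupType) (G : {group aT}).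

Definition socle : {group aT} :=
  <<\bigcup_(N : {group aT} | minnormal N G && (N \subset G)) N>>%G.

Definition almost_simple : Prop := simple socle /\ ~~ abelian socle.

End AlmostSimple.

Section AlternatingStandard.

Variables (aT : finGroupType) (G : {group aT}).
Variables (Omega : finType) (to : {action aT &-> Omega}).

(* [f] identifies the G-set Omega with the set [D] of points of the G-set T. *)
Definition equivalent_to_action_on
    (T : finType) (toT : {action aT &-> T}) (D : {set T}) : Prop :=
  exists f : Omega -> T,
    [/\ injective f, f @: [set: Omega] = D
      & forall g x, g \in G -> f (to x g) = toT (f x) g].

Definition k_subsets (n k : nat) : {set {set 'I_n}} :=
  [set A : {set 'I_n} | #|A| == k].

Definition uniform_partitions (n b : nat) : {set {set {set 'I_n}}} :=
  [set P | partition P [set: 'I_n] && [forall B in P, #|B| == b]].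

(* The socle is A_n through an action [pts] of the group on {1, .., n};
   [pts^*] and [pts^*^*] are the induced actions on sets and sets of sets. *)
Definition alternating_standard : Prop :=
  exists (n : nat) (pts : {action aT &-> 'I_n}),
    [/\ [faithful socle G, on [set: 'I_n] | pts],
        actperm pts @* socle G = 'Alt_('I_n)
      & (exists k, equivalent_to_action_on (pts^*)%act (k_subsets n k))
        \/ (exists b, equivalent_to_action_on (pts^*^*)%act
                        (uniform_partitions n b))].

End AlternatingStandard.

Section PGammaL2.

Variable F : finFieldType.

Local Notation V := 'rV[F]_2.

Definition semilinear (g : {perm V}) : Prop :=
  exists sigma : {rmorphism F -> F},
    forall (a : F) (u v : V), g (a *: u + v)%R = (sigma a *: g u + g v)%R.

Definition GammaL2_set : {set {perm V}} := [set g | `[< semilinear g >]].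

Lemma GammaL2_group_set : group_set GammaL2_set.
Proof.
apply/group_setP; split=> [|g h].
  by rewrite inE; apply/asboolP; exists idfun => a u v; rewrite !perm1.
rewrite !inE => /asboolP[s gs] /asboolP[t ht]; apply/asboolP.
by exists (t \o s) => a u v; rewrite !permM gs ht.
Qed.

Canonical GammaL2 := Group GammaL2_group_set.

Definition scalars2_set : {set {perm V}} :=
  [set g : {perm V} | [exists a : F, (a != 0%R) && [forall v, g v == (a *: v)%R]]].

Lemma scalars2_group_set : group_set scalars2_set.
Proof.
apply/group_setP; split=> [|g h].
  rewrite inE; apply/existsP; exists 1%R; rewrite oner_neq0.
  by apply/forallP=> v; rewrite perm1 scale1r.
rewrite !inE => /existsP[a /andP[a0 /forallP ga]] /existsP[b /andP[b0 /forallP hb]].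
apply/existsP; exists (b * a)%R; rewrite mulf_neq0 //=.
by apply/forallP=> v; rewrite permM (eqP (hb _)) (eqP (ga _)) scalerA.
Qed.

Canonical scalars2 := Group scalars2_group_set.

(* So GammaL2 / scalars2, defined as an image of the normaliser, is the usual quotient. *)
Lemma scalars2_normal : scalars2 <| GammaL2.
Proof.
apply/andP; split.
  apply/subsetP=> g; rewrite !inE => /existsP[a /andP[a0 /forallP ga]].
  apply/asboolP; exists idfun => b u v.
  by rewrite !(eqP (ga _)) scalerDr !scalerA mulrC.
apply/subsetP=> g; rewrite !inE => /asboolP[s gs].
have gZ a u : g (a *: u)%R = (s a *: g u)%R.
  have g0 : g 0%R = 0%R.
    by have := gs 1%R 0%R 0%R; rewrite scale1r addr0 rmorph1 scale1r => /eqP;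
       rewrite -subr_eq subrr => /eqP <-.
  by have := gs a u 0%R; rewrite addr0 g0 addr0.
apply/subsetP=> _ /imsetP[z zZ ->].
move: zZ; rewrite !inE => /existsP[a /andP[a0 /forallP za]].
apply/existsP; exists (s a); rewrite fmorph_eq0 a0.
by apply/forallP=> v; rewrite !permM (eqP (za _)) gZ permKV.
Qed.

Definition PGammaL2 : {group coset_of scalars2} := (GammaL2 / scalars2)%G.

(* PGammaL_2(F) as a group type, so that it can have total actions. *)
Definition PGammaL2_type : finGroupType := subg_of PGammaL2.

Definition PGammaL2_of (g : {perm V}) : PGammaL2_type :=
  subg PGammaL2 (coset scalars2 g).

Definition acts_reducibly (M : {set PGammaL2_type}) : Prop :=
  exists U : {vspace V},
    [/\ U != 0%VS, U != fullv
      & forall (g : {perm V}) (v : V),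
          g \in GammaL2 -> PGammaL2_of g \in M -> v \in U -> g v \in U].

Definition polar (Q : V -> F) (u v : V) : F := (Q (u + v) - Q u - Q v)%R.

Definition nondegenerate_quadratic_form (Q : V -> F) : Prop :=
  [/\ forall a v, Q (a *: v)%R = (a ^+ 2 * Q v)%R,
      forall a u v w,
        polar Q (a *: u + v)%R w = (a * polar Q u w + polar Q v w)%R
    & forall u, (forall v, polar Q u v = 0%R) -> u = 0%R].

Definition isometries (Q : V -> F) : {set {perm V}} :=
  [set g : {perm V} | [forall a : F, forall u : V, forall v : V,
                        g (a *: u + v)%R == (a *: g u + g v)%R]
                      & [forall v : V, Q (g v) == Q v]].

(* O_2^+(q) or O_2^-(q) with q even. The polar form of Q is then a nondegenerate
   alternating form, unique up to scaling, so O(Q) is a subgroup of Sp_2(q). *)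
Definition even_orthogonal (M : {set PGammaL2_type}) : Prop :=
  ~~ odd #|F| /\
  exists Q : V -> F, nondegenerate_quadratic_form Q
                     /\ M = PGammaL2_of @: isometries Q.

Section Actions.

Let G : {group PGammaL2_type} := [set: PGammaL2_type]%G.

Variables (Omega : finType) (to : {action PGammaL2_type &-> Omega}).

(* The natural module of PGammaL_2(q) is F_q^2, and S = Sp_{2m}(q)' with m = 1
   when q is even. *)
Definition subspace_action : Prop :=
  [primitive G, on [set: Omega] | to] /\
  exists x : Omega, forall M : {group PGammaL2_type},
    maximal M (socle G) -> 'C_G[x | to] :&: socle G \subset M ->
    acts_reducibly M \/ even_orthogonal M.

Definition standard_action : Prop :=
  [transitive G, on [set: Omega] | to] /\
  (alternating_standard G to \/ subspace_action).

Definition nonstandard_action : Prop := almost_simple G /\ ~ standard_action.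

End Actions.

End PGammaL2.

(* Main.v *)
Require Import Defs.
From mathcomp Require Import all_boot all_order all_fingroup all_algebra all_solvable.
From mathcomp Require Import all_field.
From mathcomp Require Import boolp reals.
From mathcomp Require Import ring zify.

(** Let [q = 11^f], where [f] is the product of [k] distinct primes, and let
    [PGammaL_2(q)] act on the unordered pairs of points of the projective line over
    the field [F] of [q] elements.

    Large minimal base. Take the pairs [{oo, 0}], [{oo, 1}] and [{oo, a_r}], one
    for each prime [r] dividing [f], where [a_r] generates the subfield of order
    [11^r]. An element stabilising all of them is a field automorphism fixing
    every [a_r], hence trivial: they form a base. Removing [{oo, a_r}] never leaves
    a base, because the Frobenius power [x |-> x^(11^(f/r))] is a nontrivial field
    automorphism that fixes the other pairs. So each minimal base extracted from
    these pairs has at least [k] elements ([large_minimal_base]).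

    Primitivity. An invariant equivalence that identifies two pairs also
    identifies, after applying dilatations, two pairs with a common point, and
    then everything by triple transitivity ([pairs_primitive]).

    The action is not standard. Iwasawa's argument on the projective line shows
    that the subgroup [PSL_2(q)] generated by transvections is simple and is the
    socle ([socle_PGammaL2]). It is not alternating since
    [n! >= 11^(5 v)], [v] being the 11-adic valuation of [n!], is too large for a
    group of order at most [(q + 1)^4] and divisible by [q]
    ([not_alternating_standard]). It is not a subspace action: the stabiliser of a
    pair in the socle contains an element swapping its two points and
    another one fixing just these two, so any maximal subgroup above it is
    irreducible, and [q] is odd ([not_subspace_action]). *)

Set Implicit Arguments.
Unset Strict Implicit.
Unset Printing Implicit Defensive.

Import GRing.Theory.

(** * The action on the projective line *)

Section ProjectiveLine.

Local Open Scope group_scope.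
Local Open Scope ring_scope.

Variable F : finFieldType.

Local Notation V := 'rV[F]_2.
Local Notation G := (PGammaL2_type F).

Lemma semilinear0 (g : {perm V}) : Defs.semilinear g -> g 0 = 0.
Proof.
case=> s gs; have := gs 1 0 0.
by rewrite scale1r addr0 rmorph1 scale1r => /eqP; rewrite -subr_eq subrr => /eqP <-.
Qed.

Lemma GammaL2P (g : {perm V}) :
  reflect (exists s : {rmorphism F -> F},
             (forall a v, g (a *: v) = s a *: g v)
             /\ (forall u v, g (u + v) = g u + g v))
          (g \in GammaL2 F).
Proof.
rewrite inE; apply: (iffP (asboolP _)) => [gS|[s [gZ gD]]]; last first.
  by exists s => a u v; rewrite gD gZ.
have g0 := semilinear0 gS; case: gS => s gs; exists s; split=> [a v|u v].
  by have := gs a v 0; rewrite !addr0 g0 addr0.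
by have := gs 1 u v; rewrite rmorph1 !scale1r.
Qed.

Definition vec2 (a b : F) : V := \row_i (if i == 0 then a else b).

Lemma vec2E0 a b : vec2 a b 0 0 = a. Proof. by rewrite mxE. Qed.
Lemma vec2E1 a b : vec2 a b 0 1 = b. Proof. by rewrite mxE. Qed.

Lemma vec2_eq (u v : V) : u 0 0 = v 0 0 -> u 0 1 = v 0 1 -> u = v.
Proof.
move=> e0 e1; apply/rowP=> i.
by case: i => [[|[|]]] //= ?; [move: e0|move: e1]; congr (_ = _); congr (fun_of_matrix _ _ _);
  apply: val_inj.
Qed.

(** The projective line is encoded as [option F], with [None] for infinity:
    the vector [(a, b)] spans the point [a / b]. Every claim about PGammaL_2 then
    reduces to a computation with fractions. *)
Definition point_vec (x : option F) : V :=
  if x is Some a then vec2 a 1 else vec2 1 0.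

Definition vec_point (v : V) : option F :=
  if v 0 1 == 0 then None else Some (v 0 0 / v 0 1).

Lemma point_vecK : cancel point_vec vec_point.
Proof.
by case=> [a|]; rewrite /vec_point ?vec2E0 ?vec2E1 ?eqxx ?oner_eq0 ?divr1.
Qed.

Lemma point_vec_neq0 x : point_vec x != 0.
Proof.
apply/eqP=> e; case: x e => [a|] /rowP.
  by move/(_ 1) => /eqP; rewrite vec2E1 mxE oner_eq0.
by move/(_ 0) => /eqP; rewrite vec2E0 mxE oner_eq0.
Qed.

Lemma vec_pointZ a v : a != 0 -> vec_point (a *: v) = vec_point v.
Proof.
move=> a0; rewrite /vec_point !mxE mulf_eq0 (negPf a0) /=.
case: ifP => // /negbT v0; congr Some; field.
by rewrite v0 a0.
Qed.

Lemma vec_pointK v : v != 0 ->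
  exists2 a, a != 0 & v = a *: point_vec (vec_point v).
Proof.
move=> v0; rewrite /vec_point; case: eqP => [e|/eqP e].
  exists (v 0 0).
    apply: contraNneq v0 => e0; apply/eqP; apply: vec2_eq; rewrite ?mxE //.
  by apply: vec2_eq; rewrite !mxE /= ?mulr1 ?mulr0.
exists (v 0 1) => //; apply: vec2_eq; rewrite !mxE /= ?mulr1 //.
by rewrite mulrC divfK.
Qed.

(** Elements of PGammaL_2 are cosets of scalars; since scalars act trivially on
    lines, any representative serves to define the action on points. *)
Definition lift2 (g : G) : {perm V} := repr (sgval g).

Lemma lift2N g : lift2 g \in 'N(scalars2 F)%g.
Proof. exact: repr_coset_norm. Qed.

Lemma lift2_GammaL g : lift2 g \in GammaL2 F.
Proof.
rewrite -(quotientGK (scalars2_normal F)) mem_morphpre ?lift2N //=.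
by rewrite coset_reprK; exact: (subgP g).
Qed.

Lemma lift2K g : PGammaL2_of (lift2 g) = g.
Proof. by apply: val_inj; rewrite /PGammaL2_of coset_reprK /= sgvalK. Qed.

Lemma GammaL2_norm g : g \in GammaL2 F -> g \in 'N(scalars2 F)%g.
Proof. by move/(subsetP (normal_norm (scalars2_normal F))). Qed.

Lemma sgval_PGammaL2_of g : g \in GammaL2 F ->
  sgval (PGammaL2_of g) = coset (scalars2 F) g.
Proof. by move=> gG; rewrite subgK // mem_quotient. Qed.

Lemma PGammaL2_ofM g h : g \in GammaL2 F -> h \in GammaL2 F ->
  PGammaL2_of (g * h)%g = (PGammaL2_of g * PGammaL2_of h)%g.
Proof.
move=> gG hG; apply: val_inj; rewrite /= !sgval_PGammaL2_of ?groupM //.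
by rewrite morphM ?GammaL2_norm.
Qed.

Lemma GammaL2_eq0 g v : g \in GammaL2 F -> (g v == 0) = (v == 0).
Proof.
rewrite inE => /asboolP/semilinear0 g0.
by rewrite -{1}g0 (inj_eq perm_inj).
Qed.

Lemma lift2_scalar g : g \in GammaL2 F ->
  exists2 a, a != 0 & forall v, g v = lift2 (PGammaL2_of g) (a *: v).
Proof.
move=> gG.
have : g \in (scalars2 F :* lift2 (PGammaL2_of g))%g.
  apply/(rcoset_kercosetP (GammaL2_norm gG) (lift2N _)).
  by rewrite coset_reprK sgval_PGammaL2_of.
case/rcosetP=> z; rewrite inE => /existsP[a /andP[a0 /forallP za]] eg.
by exists a => // v; rewrite {1}eg permM (eqP (za v)).
Qed.

Definition line_act (x : option F) (g : G) : option F :=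
  vec_point (lift2 g (point_vec x)).

Lemma line_actE g v : g \in GammaL2 F -> v != 0 ->
  line_act (vec_point v) (PGammaL2_of g) = vec_point (g v).
Proof.
move=> gG v0; have [a a0 ->] := lift2_scalar gG.
have [b b0 {2}->] := vec_pointK v0.
have /GammaL2P[s [sZ _]] := lift2_GammaL (PGammaL2_of g).
by rewrite !sZ !vec_pointZ ?fmorph_eq0.
Qed.

Lemma line_act1 : line_act^~ 1%g =1 id.
Proof.
move=> x; have {1}<- : PGammaL2_of (1 : {perm V})%g = 1%g :> G.
  by apply: val_inj; rewrite /= sgval_PGammaL2_of ?group1 // morph1.
rewrite -{1}(point_vecK x) line_actE ?group1 ?point_vec_neq0 // perm1.
exact: point_vecK.
Qed.

Lemma line_actM x : act_morph line_act x.
Proof.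
move=> g h; rewrite -{1}(lift2K g) -{1}(lift2K h).
rewrite -PGammaL2_ofM ?lift2_GammaL // -{1}(point_vecK x).
rewrite line_actE ?groupM ?lift2_GammaL ?point_vec_neq0 // permM.
rewrite -{2}(lift2K h) line_actE ?lift2_GammaL //.
by rewrite GammaL2_eq0 ?lift2_GammaL ?point_vec_neq0.
Qed.

Definition line_action : {action G &-> option F} :=
  TotalAction line_act1 line_actM.

Local Notation pact := line_action.

Lemma line_actionE g v : g \in GammaL2 F -> v != 0 ->
  pact (vec_point v) (PGammaL2_of g) = vec_point (g v).
Proof. exact: line_actE. Qed.

Lemma vec_point_fix v x : v != 0 -> vec_point v = x ->
  exists2 a, a != 0 & v = a *: point_vec x.
Proof. by move=> v0 <-; exact: vec_pointK. Qed.

(** The images of [e1], [e2] and [e1 + e2] being multiples of themselves, the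
    three factors agree, so only the field homomorphism is left. *)
Lemma fix_frame (g : G) :
  pact None g = None -> pact (Some 0) g = Some 0 -> pact (Some 1) g = Some 1 ->
  exists s : {rmorphism F -> F}, exists2 a : F, a != 0 &
    forall u v, lift2 g (vec2 u v) = a *: vec2 (s u) (s v).
Proof.
have gG := lift2_GammaL g; have /GammaL2P[s [sZ sD]] := gG.
have g0 x : lift2 g (point_vec x) != 0 by rewrite GammaL2_eq0 ?point_vec_neq0.
move=> /(vec_point_fix (g0 _))[a a0 /= e1] /(vec_point_fix (g0 _))[b b0 /= e2].
move=> /(vec_point_fix (g0 _))[c c0 /= e3].
have e u v : lift2 g (vec2 u v) = vec2 (s u * a) (s v * b).
  have -> : vec2 u v = u *: vec2 1 0 + v *: vec2 0 1.
    by apply: vec2_eq; rewrite !mxE /= ?mulr0 ?mulr1 ?addr0 ?add0r.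
  rewrite sD !sZ e1 e2; apply: vec2_eq; rewrite !mxE /=; ring.
have := e 1 1; rewrite e3 !rmorph1 !mul1r => ec.
have [ac bc] : c = a /\ c = b.
  split; [move/rowP/(_ 0): ec|move/rowP/(_ 1): ec]; rewrite !mxE /=; by rewrite mulr1.
exists s, a => // u v; rewrite e -bc ac; apply: vec2_eq; rewrite !mxE /=; ring.
Qed.

Lemma fix_frame_Some (g : G) :
  pact None g = None -> pact (Some 0) g = Some 0 -> pact (Some 1) g = Some 1 ->
  exists s : {rmorphism F -> F}, forall x, pact (Some x) g = Some (s x).
Proof.
move=> h1 h2 h3; have [s [a a0 e]] := fix_frame h1 h2 h3; exists s => x.
rewrite /= /line_act /= e vec_pointZ // rmorph1; exact: (point_vecK (Some (s x))).
Qed.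

(** Faithfulness lets every later identity in PGammaL_2 be checked pointwise on
    the projective line. *)
Lemma line_act_inj (g h : G) : (forall x, pact x g = pact x h) -> g = h.
Proof.
suff faith k : (forall x, pact x k = x) -> k = 1%g.
  move=> e; apply/eqP; rewrite eq_mulgV1; apply/eqP/faith=> x.
  by rewrite actM e -actM mulgV act1.
move=> fk; have [s [a a0 e]] := fix_frame (fk _) (fk _) (fk _).
have sid x : s x = x.
  apply: Some_inj; rewrite -[in RHS](fk (Some x)) /= /line_act /= e vec_pointZ //.
  by rewrite rmorph1; exact/esym/(point_vecK (Some (s x))).
apply: val_inj; rewrite -[k]lift2K /= sgval_PGammaL2_of ?lift2_GammaL //=.
apply: coset_id; rewrite inE; apply/existsP; exists a; rewrite a0.
apply/forallP=> v; have -> : v = vec2 (v 0 0) (v 0 1).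
  by apply: vec2_eq; rewrite !mxE.
by rewrite e !sid.
Qed.

(** The element [[x : y] |-> [s x * a + s y * b : s x * c + s y * d]]; all
    explicit elements below are instances. *)
Lemma semilinear_elt (s : {rmorphism F -> F}) (a b c d : F) :
  a * d - b * c != 0 ->
  {g : G | forall x, pact x g = vec_point
      (let v := point_vec x in
       vec2 (s (v 0 0) * a + s (v 0 1) * b) (s (v 0 0) * c + s (v 0 1) * d))}.
Proof.
move=> det0.
pose h (v : V) := vec2 (s (v 0 0) * a + s (v 0 1) * b) (s (v 0 0) * c + s (v 0 1) * d).
have h_inj : injective h.
  move=> u v /rowP e; have := e 0; have := e 1; rewrite !mxE /= => e1 e0.
  have d0 : s (u 0 0) - s (v 0 0) = 0.
    apply: (mulIf det0); rewrite mul0r.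
    transitivity ((s (u 0 0) * a + s (u 0 1) * b - (s (v 0 0) * a + s (v 0 1) * b)) * d
      - (s (u 0 0) * c + s (u 0 1) * d - (s (v 0 0) * c + s (v 0 1) * d)) * b); first ring.
    by rewrite e0 e1; ring.
  have d1 : s (u 0 1) - s (v 0 1) = 0.
    apply: (mulIf det0); rewrite mul0r.
    transitivity ((s (u 0 0) * c + s (u 0 1) * d - (s (v 0 0) * c + s (v 0 1) * d)) * a
     - (s (u 0 0) * a + s (u 0 1) * b - (s (v 0 0) * a + s (v 0 1) * b)) * c); first ring.
    by rewrite e0 e1; ring.
  by apply: vec2_eq; apply: (fmorph_inj s); apply/eqP; rewrite -subr_eq0 ?d0 ?d1.
have hG : perm h_inj \in GammaL2 F.
  apply/GammaL2P; exists s; split=> [k v|u v]; rewrite !permE; apply: vec2_eq;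
  rewrite !mxE /= ?rmorphM ?rmorphD /=; ring.
exists (PGammaL2_of (perm h_inj)) => x.
by rewrite -{1}(point_vecK x) line_actionE ?point_vec_neq0 // permE.
Qed.

Fact transl_key b : (1 : F) * 1 - b * 0 != 0.
Proof. by rewrite mulr0 subr0 mulr1 oner_eq0. Qed.
Definition transl (b : F) : G := sval (semilinear_elt idfun (transl_key b)).

Fact dilat_key (a : {unit F}) : val a * 1 - 0 * 0 != 0.
Proof. by rewrite mulr0 subr0 mulr1 -unitfE (valP a). Qed.
Definition dilat (a : {unit F}) : G := sval (semilinear_elt idfun (dilat_key a)).

Fact winv_key : (0 : F) * 0 - (-1) * 1 != 0.
Proof. by rewrite mul0r sub0r mulr1 opprK oner_eq0. Qed.
(** The involution [x |-> -1/x]. *)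
Definition winv : G := sval (semilinear_elt idfun winv_key).

Fact fieldaut_key : (1 : F) * 1 - 0 * 0 != 0.
Proof. by rewrite mulr0 subr0 mulr1 oner_eq0. Qed.
Definition fieldaut (s : {rmorphism F -> F}) : G := sval (semilinear_elt s fieldaut_key).

Lemma translE b :
  (pact None (transl b) = None) * (forall x, pact (Some x) (transl b) = Some (x + b)).
Proof.
split=> [|x]; rewrite (svalP (semilinear_elt _ _)) /vec_point !mxE /=
  !(mulr0, mul0r, mulr1, mul1r, addr0, add0r) ?eqxx // oner_eq0.
by rewrite divr1.
Qed.

Lemma dilatE a :
  (pact None (dilat a) = None) * (forall x, pact (Some x) (dilat a) = Some (val a * x)).
Proof.
split=> [|x]; rewrite (svalP (semilinear_elt _ _)) /vec_point !mxE /=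
  !(mulr0, mul0r, mulr1, mul1r, addr0, add0r) ?eqxx // oner_eq0.
by rewrite divr1 mulrC.
Qed.

Lemma fieldautE s :
  (pact None (fieldaut s) = None) * (forall x, pact (Some x) (fieldaut s) = Some (s x)).
Proof.
split=> [|x]; rewrite (svalP (semilinear_elt _ _)) /vec_point !mxE /=
  !(mulr0, mul0r, mulr1, mul1r, addr0, add0r, rmorph1, rmorph0) ?eqxx // oner_eq0.
by rewrite divr1.
Qed.

Lemma winvE :
  (pact None (winv) = Some 0) *
  (forall x, pact (Some x) winv = if x == 0 then None else Some (- x^-1)).
Proof.
split=> [|x]; rewrite (svalP (semilinear_elt _ _)) /vec_point !mxE /=
  !(mulr0, mul0r, mulr1, mul1r, addr0, add0r) ?oner_eq0 //.
by case: eqP => // _; rewrite mulN1r.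
Qed.

End ProjectiveLine.

(** * The socle *)

Section Socle.

Local Open Scope ring_scope.
Local Open Scope group_scope.

Variable F : finFieldType.

Local Notation G := (PGammaL2_type F).
Local Notation pact := (line_action F).

Lemma translD (a b : F) : transl (a + b)%R = transl a * transl b.
Proof.
by apply: line_act_inj => -[x|]; rewrite actM !translE // addrA.
Qed.

Lemma transl0 : transl (0%R : F) = 1.
Proof. by apply: line_act_inj => -[x|]; rewrite act1 translE ?addr0. Qed.

Lemma transl_inj : injective (@transl F).
Proof.
move=> a b e; have := (translE a).2 0%R; rewrite e translE.
by rewrite !add0r => -[].
Qed.

Definition transl_set : {set G} := [set transl b | b : F].

Lemma mem_transl b : transl b \in transl_set.
Proof. exact: imset_f. Qed.

Lemma transl_group_set : group_set transl_set.
Proof.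
apply/group_setP; split=> [|_ _ /imsetP[a _ ->] /imsetP[b _ ->]].
  by rewrite -transl0 mem_transl.
by rewrite -translD mem_transl.
Qed.
Canonical transl_group := Group transl_group_set.

Lemma card_transl : #|transl_set| = #|F|.
Proof. by rewrite card_imset //; exact: transl_inj. Qed.

Lemma transl_abelian : abelian transl_group.
Proof.
apply/centsP=> _ /imsetP[a _ ->] _ /imsetP[b _ ->].
by rewrite /commute -!translD addrC.
Qed.

(** Compose with a translation and a dilatation so as to fix 0, 1 and infinity;
    what remains is a field homomorphism. *)
Lemma stab_None_affine (g : G) : pact None g = None ->
  exists s : {rmorphism F -> F}, exists a c : F, forall x,
    pact (Some x) g = Some (s x * a + c)%R.
Proof.
move=> gN.
have ex x : {y | pact (Some x) g = Some y}.
  case e: (pact (Some x) g) => [y|]; first by exists y.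
  by move: e; rewrite -gN => /act_inj.
have [c ec] := ex 0%R; have [d ed] := ex 1%R.
have dc : (d - c != 0)%R.
  rewrite subr_eq0; apply: contra_neq (oner_neq0 F) => e.
  by move: ed; rewrite e -ec => /act_inj [].
have dcU : ((d - c)^-1 \is a GRing.unit)%R by rewrite unitfE invr_eq0.
pose k := g * transl (- c)%R * dilat (FinRing.unit F dcU).
have kE x y : pact (Some x) g = Some y -> pact (Some x) k = Some ((d - c)^-1 * (y - c))%R.
  by move=> e; rewrite 2!actM e translE dilatE.
have [||| s sE] := @fix_frame_Some _ k.
- by rewrite 2!actM gN translE dilatE.
- by rewrite (kE _ _ ec) subrr mulr0.
- by rewrite (kE _ _ ed) mulVf.
exists s, (d - c)%R, c => x; have [y ey] := ex x.
by move: (sE x); rewrite (kE _ _ ey) ey => -[<-]; congr Some; rewrite mulrC mulVKf // subrK.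
Qed.

(** Conjugating [x |-> x + b] by [x |-> s x * a + c] gives
    [x |-> x + s b * a]: the translations are normal in the stabiliser of
    infinity, as Iwasawa's argument requires. *)
Lemma transl_conj_stab (g : G) b : pact None g = None ->
  transl b ^ g \in transl_set.
Proof.
move=> gN; have [s [a [c e]]] := stab_None_affine gN.
suff -> : transl b ^ g = transl (s b * a)%R by rewrite mem_transl.
apply: line_act_inj => y; rewrite -(actKV pact g y) -actCJ.
case: (pact y g^-1) => [x|]; last by rewrite translE gN translE.
by rewrite translE !e translE rmorphD mulrDl addrAC.
Qed.

(** PSL_2 as the normal closure of the translations, i.e. the group generated by
    all transvections: its normality in PGammaL_2 then holds by construction. *)
Definition PSL2 : {group G} := <<class_support transl_set [set: G]>>%G.

Lemma transl_conj_PSL2 b g : transl b ^ g \in PSL2.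
Proof. by rewrite mem_gen // memJ_class_support ?mem_transl ?inE. Qed.

Lemma transl_PSL2 b : transl b \in PSL2.
Proof. by rewrite -[transl b]conjg1 transl_conj_PSL2. Qed.

Lemma PSL2_normal : PSL2 <| [set: G].
Proof.
rewrite /normal subsetT norms_gen //; apply/subsetP=> g _.
by rewrite inE class_supportGidr ?inE.
Qed.

Lemma PSL2_conj s g : s \in PSL2 -> s ^ g \in PSL2.
Proof.
move=> sS; rewrite memJ_norm //.
by apply: (subsetP (normal_norm PSL2_normal)); rewrite inE.
Qed.

Lemma move_None x : exists g : G, pact None g = x.
Proof.
case: x => [x|]; last by exists 1; rewrite act1.
by exists (winv F * transl x); rewrite actM winvE translE add0r.
Qed.

Lemma root_subgroup_trans x y z : y != x -> z != x ->
  exists2 u, u \in PSL2 & pact x u = x /\ pact y u = z.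
Proof.
have [g <-] := move_None x => yx zx.
have [y' ey] : exists y', y = pact (Some y') g.
  case e: (pact y g^-1) => [y'|]; first by exists y'; rewrite -e actKV.
  by case/eqP: yx; rewrite -e actKV.
have [z' ez] : exists z', z = pact (Some z') g.
  case e: (pact z g^-1) => [z'|]; first by exists z'; rewrite -e actKV.
  by case/eqP: zx; rewrite -e actKV.
exists (transl (z' - y')%R ^ g); first exact: transl_conj_PSL2.
by rewrite ey ez -!actCJ !translE subrKC.
Qed.

Lemma third_point (x y : option F) : exists2 z, z != x & z != y.
Proof.
have : ~~ ([set: option F] \subset [set x; y]).
  apply/negP=> /subset_leq_card; rewrite cardsT card_option cards2 => h.
  have : (2 < #|F|.+1)%N by rewrite ltnS finRing_gt1.
  by rewrite ltnNge (leq_trans h) //; case: (_ != _).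
by case/subsetPn=> z _; rewrite !inE negb_or => /andP[]; exists z.
Qed.

(** The root subgroup at a point is transitive on the other points; move [x] with
    the root subgroup of a third point, then [y] with that of [x']. *)
Lemma PSL2_2trans x y x' y' : x != y -> x' != y' ->
  exists2 s, s \in PSL2 & pact x s = x' /\ pact y s = y'.
Proof.
move=> xy xy'; have [w wx wx'] := third_point x x'.
have [u uS [_ ux]] := @root_subgroup_trans w x x' ltac:(by rewrite eq_sym) ltac:(by rewrite eq_sym).
have [v vS [vx' vy]] := @root_subgroup_trans x' (pact y u) y'
   ltac:(by rewrite -ux (inj_eq (act_inj _ _)) eq_sym) ltac:(by rewrite eq_sym).
by exists (u * v); rewrite ?groupM // !actM ux vx'.
Qed.

Lemma winvV : (winv F)^-1 = winv F.
Proof.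
apply/eqP; rewrite eq_invg_mul; apply/eqP/line_act_inj=> -[x|].
  rewrite actM act1 winvE; case: eqP => [->|/eqP x0]; rewrite winvE //.
  by rewrite oppr_eq0 invr_eq0 (negPf x0) invrN invrK opprK.
by rewrite actM act1 !winvE eqxx.
Qed.

(** The Weyl element is a product of three transvections; in matrices,
    [(0 1; -1 0) = (1 1; 0 1) (1 0; -1 1) (1 1; 0 1)]. *)
Lemma winv_PSL2 : winv F \in PSL2.
Proof.
suff -> : winv F = transl 1%R * transl 1%R ^ winv F * transl 1%R.
  by apply: groupM (transl_PSL2 _); apply: groupM (transl_PSL2 _) (transl_conj_PSL2 _ _).
apply: line_act_inj => -[x|]; rewrite conjgE winvV !actM; last first.
  by rewrite !(translE, winvE) add0r oner_eq0 translE invr1 addNr.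
rewrite translE !winvE.
have [x1|x1] := eqVneq (x + 1)%R 0%R.
  rewrite translE !winvE !translE.
  have -> : x = (-1)%R by apply/eqP; rewrite -addr_eq0 x1.
  by rewrite oppr_eq0 oner_eq0 invrN1 opprK add0r.
rewrite translE winvE.
have [->|x0] := eqVneq x 0%R; first by rewrite add0r invr1 addNr eqxx; exact/esym/(translE _).1.
have e : (- (x + 1)^-1 + 1)%R = (x / (x + 1))%R by field.
have e0 : (x / (x + 1) == 0)%R = false.
  by rewrite mulf_eq0 invr_eq0 (negPf x0) (negPf x1).
rewrite e e0 translE; congr Some; field.
by rewrite x0 x1.
Qed.

(** [x |-> c^2 x] is diag(c, c^-1), a commutator of the Weyl element with the
    dilatation by [c]. *)
Lemma dilat_sqr_PSL2 (c : {unit F}) : dilat (c * c) \in PSL2.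
Proof.
suff -> : dilat (c * c) = winv F * winv F ^ dilat c.
  by rewrite groupM ?PSL2_conj ?winv_PSL2.
have cU : (val c != 0)%R by rewrite -unitfE (valP c).
apply: line_act_inj => x; rewrite -[x](actKV pact (winv F)).
move: (pact x _) => {}x; rewrite actM -{3}winvV actK.
rewrite -[x in RHS](actKV pact (dilat c)) -actCJ.
have := actKV pact (dilat c) x; case: (pact x _) => [z|] <-; last first.
  by rewrite !(dilatE, winvE) !mulr0.
rewrite !(dilatE, winvE) mulf_eq0 (negPf cU) orFb.
have [_|z0] := eqVneq z 0%R; rewrite !dilatE //; congr Some; rewrite FinRing.val_unitM; field.
by rewrite z0 cU.
Qed.

Hypothesis F_gt3 : (3 < #|F|)%N.

Lemma unit_sqr_neq1 : exists c : {unit F}, ((val c * val c)%R != 1%R).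
Proof.
have : ~~ ([set: F] \subset [set 0%R; 1%R; (-1)%R]).
  apply/negP=> /subset_leq_card; rewrite cardsT leqNgt => /negP[].
  apply: leq_ltn_trans F_gt3; rewrite cardsU !cards1 cards2.
  by apply: leq_trans (leq_subr _ _) _; case: (_ != _).
case/subsetPn=> c _; rewrite !inE !negb_or -andbA => /and3P[c0 c1 cN1].
have cU : c \is a GRing.unit by rewrite unitfE.
exists (FinRing.unit F cU) => /=.
by rewrite -expr2 sqrf_eq1 negb_or c1 cN1.
Qed.

(** A translation by [b] is the commutator of a translation with
    [x |-> c^2 x], as soon as [c^2 - 1] is invertible. *)
Lemma PSL2_perfect : PSL2 \subset PSL2^`(1).
Proof.
have nS : PSL2^`(1) <| [set: G] by rewrite (char_normal_trans (der_char _ _)) ?PSL2_normal.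
rewrite gen_subG; apply/subsetP=> _ /imset2P[_ g /imsetP[b _ ->] _ ->].
rewrite memJ_norm; last by apply: (subsetP (normal_norm nS)); rewrite inE.
have [c c1] := unit_sqr_neq1; pose d := (val c * val c)%R.
have d1 : (d - 1 != 0)%R by rewrite subr_eq0.
suff -> : transl b = [~ transl (b / (d - 1))%R, dilat (c * c)].
  by rewrite mem_commg ?transl_PSL2 ?dilat_sqr_PSL2.
rewrite commgEl; apply: (mulgI (transl (b / (d - 1))%R)); rewrite mulKVg -translD.
apply: line_act_inj => x; rewrite -(actKV pact (dilat (c * c)) x) -actCJ.
case: (pact x _) => [y|]; rewrite !(dilatE, translE) //.
by congr Some; rewrite FinRing.val_unitM -/d; field.
Qed.

(** Iwasawa's argument. By double transitivity of [PSL2], [N] is transitive on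
    points, so each conjugate of the group [U] of translations is a conjugate
    under [N], whence [PSL2 <= N U]. Then [PSL2 / N] is abelian, and perfectness
    gives [PSL2 <= N]. Only normalisation by [PSL2] is assumed, so that the lemma
    yields both the simplicity of [PSL2] and the fact that it is the only minimal
    normal subgroup of PGammaL_2. *)
Lemma PSL2_sub_normalised (N : {group G}) :
  PSL2 \subset 'N(N) -> N :!=: 1 -> PSL2 \subset N.
Proof.
move=> nN N1.
have [n nNn [x nx]] : exists2 n, n \in N & exists x, pact x n != x.
  have /trivgPn[n nNn n1] := N1; exists n => //.
  apply/existsP; apply: contraNT n1; rewrite negb_exists => /forallP h.
  apply/eqP/line_act_inj=> x; rewrite act1; apply/eqP; by move: (h x); rewrite negbK.
have trN y z : exists2 m, m \in N & pact y m = z.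
  have [->|yz] := eqVneq y z; first by exists 1; rewrite ?act1.
  have [s sS [sx sz]] := @PSL2_2trans x (pact x n) y z ltac:(by rewrite eq_sym) yz.
  exists (n ^ s); first by rewrite memJ_norm // (subsetP nN).
  by rewrite -sx -actCJ.
have tN : transl_set \subset 'N(N).
  by apply: subset_trans nN; apply/subsetP=> _ /imsetP[b _ ->]; exact: transl_PSL2.
have SNU : PSL2 \subset N <*> transl_group.
  rewrite gen_subG; apply/subsetP=> _ /imset2P[_ g /imsetP[b _ ->] _ ->].
  have [m mN em] := trN None (pact None g).
  rewrite -[g](mulgKV m) conjgM groupJ ?mem_gen //; last by rewrite inE mN.
  by rewrite inE transl_conj_stab ?orbT // actM -em actK.
apply: subset_trans PSL2_perfect _.
apply: der1_min => //; apply: abelianS (quotientS N SNU) _.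
rewrite quotientYidl // quotient_abelian //; exact: transl_abelian.
Qed.

Lemma PSL2_neq1 : PSL2 :!=: 1.
Proof.
apply/trivgPn; exists (transl 1%R); first exact: transl_PSL2.
by rewrite -transl0 (inj_eq transl_inj) oner_eq0.
Qed.

Lemma PSL2_simple : simple PSL2.
Proof.
apply/simpleP; split=> [|H /andP[sH nH]]; first exact: PSL2_neq1.
have [->|H1] := eqVneq H 1%G; [by left | right].
by apply/eqP; rewrite eqEsubset sH PSL2_sub_normalised // ?trivg_card1.
Qed.

Lemma PSL2_nonabelian : ~~ abelian PSL2.
Proof.
apply: contra PSL2_neq1 => /derG1P d1.
by rewrite -subG1 -d1 PSL2_perfect.
Qed.

Lemma socle_PGammaL2 : socle [set: G]%G = PSL2.
Proof.
have nS := normal_norm PSL2_normal.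
apply/val_inj/eqP; rewrite /= eqEsubset; apply/andP; split.
  rewrite gen_subG; apply/bigcupsP=> N /andP[/mingroupP[/andP[N1 nN] minN] _].
  rewrite (minN PSL2) //; first by rewrite PSL2_neq1 nS.
  by rewrite PSL2_sub_normalised // (subset_trans _ nN) ?subsetT.
rewrite sub_gen // (bigcup_max PSL2) // subsetT andbT.
apply/mingroupP; split=> [|H /andP[H1 nH] sH]; first by rewrite PSL2_neq1 nS.
by apply/eqP; rewrite eqEsubset sH PSL2_sub_normalised // (subset_trans _ nH) ?subsetT.
Qed.

Lemma PGammaL2_almost_simple : almost_simple [set: G]%G.
Proof. by rewrite /almost_simple socle_PGammaL2 PSL2_simple PSL2_nonabelian. Qed.

End Socle.

(** * Primitivity on pairs of points *)

Section Primitivity.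

Local Open Scope ring_scope.
Local Open Scope group_scope.

Variables (aT : finGroupType) (T : finType) (to : {action aT &-> T}).

(** Lying in the same block is an invariant equivalence, so primitivity can be
    checked on equivalences instead of partitions. *)
Lemma primitive_of_congruences :
  [transitive [set: aT], on [set: T] | to] ->
  (forall R : rel T, {in predT & &, equivalence_rel R} ->
     (forall g x y, R x y -> R (to x g) (to y g)) ->
     (forall x y, R x y -> x = y) \/ (forall x y, R x y)) ->
  [primitive [set: aT], on [set: T] | to].
Proof.
move=> trG hR; rewrite /primitive trG; apply/existsP=> -[Q].
case/and4P=> pQ aQ Q1 QT; have /and3P[/eqP cQ tQ Q0] := pQ.
have memQ x : pblock Q x \in Q by rewrite pblock_mem // cQ inE.
have memx x : x \in pblock Q x by rewrite mem_pblock cQ inE.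
have [|g x y xy|triv|univ] := hR (fun x y => y \in pblock Q x).
- have := pblock_equivalence pQ => h x y z _ _ _; apply: h; exact: in_setT.
- rewrite (def_pblock tQ _ (mem_setact to g (memx x))).
    exact: mem_setact.
  by rewrite (actsP aQ) ?inE ?memQ.
- move: QT; rewrite (card_partition pQ) ltnNge -sum1_card leq_sum // => B BQ.
  rewrite leqNgt; apply/negP=> /card_gt1P[x [y [xB yB /eqP[]]]].
  by apply: triv; rewrite (def_pblock tQ BQ xB).
case/card_gt1P: Q1 => B [C [BQ CQ /eqP[]]].
have nz D : D \in Q -> exists x, x \in D.
  by move=> DQ; apply/set0Pn; apply: contraNneq Q0 => <-.
have [[x xB] [y yC]] := (nz _ BQ, nz _ CQ).
have := univ x y; rewrite (def_pblock tQ BQ xB) => yB.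
by rewrite -(def_pblock tQ BQ yB) (def_pblock tQ CQ yC).
Qed.

Definition point_pair := {A : {set T} | #|A| == 2}.

Lemma pair_act_key (A : point_pair) g : #|(to^*)%act (val A) g| == 2.
Proof. by rewrite card_setact (valP A). Qed.

Definition pair_act (A : point_pair) g : point_pair :=
  exist (fun B : {set T} => #|B| == 2) _ (pair_act_key A g).

Lemma pair_act1 : pair_act^~ 1 =1 id.
Proof. by move=> A; apply: val_inj; rewrite /= act1. Qed.

Lemma pair_actM A : act_morph pair_act A.
Proof. by move=> g h; apply: val_inj; rewrite /= actM. Qed.

Definition pair_action : {action aT &-> point_pair} :=
  TotalAction pair_act1 pair_actM.

Lemma val_pair_action A g : val (pair_action A g) = (to^*)%act (val A) g.
Proof. by []. Qed.

Lemma setact2 x y g : (to^*)%act [set x; y] g = [set to x g; to y g].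
Proof. by rewrite /= /setact imsetU1 imset_set1. Qed.

Lemma point_pairP (A : point_pair) : exists x y, x != y /\ val A = [set x; y].
Proof. by have /cards2P[x [y [xy e]]] := valP A; exists x, y. Qed.

Lemma point_pair_exists x y : x != y -> exists A : point_pair, val A = [set x; y].
Proof.
move=> xy; have h : #|[set x; y]| == 2 by rewrite cards2 xy.
by exists (exist (fun B : {set T} => #|B| == 2) _ h).
Qed.

End Primitivity.

Section PairsPrimitive.

Local Open Scope ring_scope.
Local Open Scope group_scope.
Variable F : finFieldType.

Local Notation G := (PGammaL2_type F).
Local Notation pact := (line_action F).
Local Notation pact2 := (pair_action (line_action F)).

Lemma line_3trans x y z : x != y -> x != z -> y != z ->
  exists g : G, [/\ pact None g = x, pact (Some 0%R) g = y & pact (Some 1%R) g = z].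
Proof.
move=> xy xz yz; have [s _ [sx sy]] := @PSL2_2trans F None (Some 0%R) x y isT xy.
have ez := actKV pact s z; case: (pact z _) ez => [c|] ez; last first.
  by case/eqP: xz; rewrite -sx -ez.
have c0 : c != 0%R by apply: contraNneq yz => c0; rewrite -sy -ez c0.
have cU : c \is a GRing.unit by rewrite unitfE.
exists (dilat (FinRing.unit F cU) * s).
by rewrite !actM !dilatE mulr0 mulr1 sx sy ez.
Qed.

Lemma pairs_trans : [transitive [set: G], on setT | pact2].
Proof.
have [A eA] := @point_pair_exists _ None (Some (0%R : F)) isT.
apply/imsetP; exists A; rewrite ?inE //; apply/setP=> B; rewrite inE; apply/esym/imsetP.
have [x [y [xy eB]]] := point_pairP B.
have [s _ [sx sy]] := @PSL2_2trans F None (Some 0%R) x y isT xy.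
exists s; rewrite ?inE //; apply: val_inj.
by rewrite val_pair_action eA eB setact2 sx sy.
Qed.

Hypotheses (F2 : (2%:R != 0 :> F)%R) (F3 : (3%:R != 0 :> F)%R) (F5 : (5%:R != 0 :> F)%R).

Section Congruence.
Variable R : rel (point_pair (option F)).
Hypothesis eqR : {in predT & &, equivalence_rel R}.
Hypothesis actR : forall (g : G) A B, R A B -> R (pact2 A g) (pact2 B g).

(* Two pairs given by their points; quantifying over all representatives
   spares the proofs that the points are distinct. *)
Let Rp x y z w := forall A B : point_pair (option F),
  val A = [set x; y] -> val B = [set z; w] -> R A B.

Let Rrefl A : R A A.
Proof. by have [] := eqR (isT : A \in predT) (isT : A \in predT) (isT : A \in predT). Qed.

Let Rtrans A B C : R A B -> R B C -> R A C.
Proof.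
move=> AB; have [_ h] := eqR (isT : A \in predT) (isT : B \in predT) (isT : C \in predT).
by rewrite (h AB).
Qed.

Let Rsym A B : R A B -> R B A.
Proof.
move=> AB; have [_ h] := eqR (isT : A \in predT) (isT : B \in predT) (isT : A \in predT).
by rewrite -(h AB).
Qed.

Let Rp_act g x y z w : Rp x y z w -> Rp (pact x g) (pact y g) (pact z g) (pact w g).
Proof.
move=> h A B eA eB; rewrite -(actKV pact2 g A) -(actKV pact2 g B); apply: actR; apply: h.
  by rewrite val_pair_action eA setact2 !actK.
by rewrite val_pair_action eB setact2 !actK.
Qed.

Let Rp_trans x y z w u v : z != w -> Rp x y z w -> Rp z w u v -> Rp x y u v.
Proof.
move=> zw h1 h2 A B eA eB; have [C eC] := point_pair_exists zw.
exact: Rtrans (h1 _ _ eA eC) (h2 _ _ eC eB).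
Qed.

Let Rp_sym x y z w : Rp x y z w -> Rp z w x y.
Proof. by move=> h A B eA eB; apply/Rsym/h. Qed.

Let Rp_C1 x y z w : Rp x y z w -> Rp y x z w.
Proof. by move=> h A B eA eB; apply/h; rewrite // eA setUC. Qed.

Let Rp_C2 x y z w : Rp x y z w -> Rp x y w z.
Proof. by move=> h A B eA eB; apply/h; rewrite // eB setUC. Qed.

(* By triple transitivity any two pairs with a common point are equivalent, and
   two disjoint pairs both meet a third one. *)
Let univ_of_meet x y z : x != y -> x != z -> y != z -> Rp x y x z ->
  forall A B, R A B.
Proof.
move=> xy xz yz h.
have [g [gx gy gz]] := line_3trans xy xz yz.
have meet0 : Rp None (Some 0%R) None (Some 1%R).
  by have := @Rp_act g^-1 _ _ _ _ h; rewrite -gx -gy -gz !actK.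
clear x y z h g xy xz yz gx gy gz.
have meet a b c : a != b -> a != c -> Rp a b a c.
  have [-> _ _|bc ab ac] := eqVneq b c; last first.
    by have [g [<- <- <-]] := line_3trans ab ac bc; apply: Rp_act.
  move=> A B eA eB; have -> : A = B by apply: val_inj; rewrite eA eB.
  exact: Rrefl.
move=> A B; have [[a [b [ab eA]]] [c [d [cd eB]]]] := (point_pairP A, point_pairP B).
move: A B eA eB; rewrite -/(Rp a b c d).
case: (eqVneq a c) cd => [<-|ac] cd; first exact: meet.
apply: (@Rp_trans _ _ a c) => //; first exact: meet.
by apply: Rp_C1; apply: meet; rewrite 1?(eq_sym c a).
Qed.

(* The dilatation by l fixes {oo, 0} and takes {1, l} to {l, l^2}, which meets
   {1, l} in exactly one point. *)
Let univ_of_ratio (l : F) : l != 0%R -> (l * l)%R != 1%R ->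
  Rp None (Some 0%R) (Some 1%R) (Some l) -> forall A B, R A B.
Proof.
move=> l0 l2 h; have lU : l \is a GRing.unit by rewrite unitfE.
have := @Rp_act (dilat (FinRing.unit F lU)) _ _ _ _ h; rewrite !dilatE /= mulr0 mulr1 => h'.
apply: (@univ_of_meet (Some l) (Some 1%R) (Some (l * l)%R)).
- by apply: contraNneq l2 => -[->]; rewrite mulr1.
- by apply: contraNneq l2 => -[e]; rewrite -e; apply/eqP/(mulfI l0); rewrite mulr1.
- by rewrite (inj_eq Some_inj) eq_sym.
exact: (@Rp_trans _ _ None (Some 0%R)) (Rp_C1 (Rp_sym h)) h'.
Qed.

(** Two equivalent disjoint pairs may be taken to be [{oo, 0}] and [{1, l}]. The
    only case in which the dilatation by [l] does not produce two meeting pairs is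
    the harmonic one, [l = -1]; there, the pairs [{1, -1}] and [{2, -2}] are
    equivalent, and in a coordinate sending the former to [{0, oo}] the latter
    becomes [{1, 9}], where [9^2 - 1 = 80] is invertible. *)
Lemma pair_congruence : (forall A B, R A B -> A = B) \/ (forall A B, R A B).
Proof.
have [triv|] := pselect (forall A B, R A B -> A = B); first by left.
move=> ntriv; right.
have [A [B [RAB AB]]] : exists A B, R A B /\ A <> B.
  apply: contrapT => h; apply: ntriv => A B RAB; apply: contrapT => AB.
  by apply: h; exists A, B.
have [[x [y [xy eA]]] [z [w [zw eB]]]] := (point_pairP A, point_pairP B).
have h : Rp x y z w.
  move=> A' B' eA' eB'; have -> : A' = A by apply: val_inj; rewrite eA' eA.
  by have -> : B' = B by apply: val_inj; rewrite eB' eB.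
have hAB : [set x; y] <> [set z; w] by rewrite -eA -eB => /val_inj.
have [xz|xz] := eqVneq x z.
  have [yw|yw] := eqVneq y w; first by case: hAB; rewrite xz yw.
  by rewrite -xz in zw h; exact: univ_of_meet xy zw yw h.
have [xw|xw] := eqVneq x w.
  have [yz|yz] := eqVneq y z; first by case: hAB; rewrite xw yz setUC.
  by rewrite -xw in h; exact: univ_of_meet xy xz yz (Rp_C2 h).
have yx : y != x by rewrite eq_sym.
have [yz|yz] := eqVneq y z.
  by rewrite -yz in zw h; exact: univ_of_meet yx zw xw (Rp_C1 h).
have [yw|yw] := eqVneq y w.
  by rewrite -yw in h; exact: univ_of_meet yx yz xz (Rp_C1 (Rp_C2 h)).
have [g [gx gy gz]] := line_3trans xy xz yz.
have ew := actKV pact g w; case: (pact w _) ew => [l|] ew; last first.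
  by case/eqP: xw; rewrite -gx -ew.
have l0 : l != 0%R by apply: contraNneq yw => l0; rewrite -gy -ew l0.
have l1 : l != 1%R by apply: contraNneq zw => l1; rewrite -gz -ew l1.
have {}h : Rp None (Some 0%R) (Some 1%R) (Some l).
  by have := @Rp_act g^-1 _ _ _ _ h; rewrite -gx -gy -gz -ew !actK.
have [l2|l2] := eqVneq (l * l)%R 1%R; last exact: (univ_of_ratio l0 l2).
have lN : l = (-1)%R.
  by move/eqP: l2; rewrite -expr2 sqrf_eq1 (negPf l1) => /eqP.
rewrite {}lN {l l0 l1 l2 ew} in h.
have U2 : (2%:R : F)%R \is a GRing.unit by rewrite unitfE.
have U3 : (3%:R : F)%R \is a GRing.unit by rewrite unitfE.
have N1 : (1 != -1 :> F)%R by rewrite -subr_eq0 opprK -(natrD _ 1 1).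
have h2 : Rp (Some 1%R) (Some (-1)%R) (Some 2%:R%R) (Some (- 2%:R)%R).
  apply: (@Rp_trans _ _ None (Some 0%R)) => //; first exact: Rp_sym.
  by have := @Rp_act (dilat (FinRing.unit F U2)) _ _ _ _ h; rewrite !dilatE /= mulr0 mulr1 mulrN1.
(* this element is x |-> 3 (x - 1) / (x + 1) *)
have := @Rp_act (transl 1%R * winv F * dilat (FinRing.unit F U2) * transl 1%R
   * dilat (FinRing.unit F U3)) _ _ _ _ h2.
rewrite !actM !translE addNr -(natrD _ 1 1) -(natrD _ 2 1) !winvE eqxx.
have e1 : (- 2%:R + 1 = -1 :> F)%R by ring.
rewrite e1 (negPf F2) (negPf F3) oppr_eq0 oner_eq0 !dilatE !translE !dilatE /=.
have -> : (3%:R * (2%:R * - 2%:R^-1 + 1) = 0 :> F)%R by field.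
have -> : (3%:R * (2%:R * - 3%:R^-1 + 1) = 1 :> F)%R by field.
have -> : (3%:R * (2%:R * - (-1)^-1 + 1) = 9%:R :> F)%R by rewrite invrN1; ring.
move=> h3; apply: (@univ_of_ratio 9%:R%R); last exact: Rp_C1.
  by rewrite (natrM _ 3 3) mulf_neq0.
rewrite -subr_eq0; have -> : (9%:R * 9%:R - 1 = 2%:R * 2%:R * 2%:R * 2%:R * 5%:R :> F)%R by ring.
by rewrite !mulf_neq0.
Qed.

End Congruence.

Lemma pairs_primitive : [primitive [set: G], on setT | pact2].
Proof.
apply: primitive_of_congruences; first exact: pairs_trans.
by move=> R eR aR; exact: (pair_congruence eR aR).
Qed.

End PairsPrimitive.

(** * The socle is not alternating *)

Section Arithmetic.
Local Open Scope nat_scope.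

(** Among the eleven new factors, [11 * m.+1] and four products of two others are
    all at least [11 * m.+1]. *)
Lemma fact_eleven_step m : (11 * m.+1) ^ 5 * (11 * m)`! <= (11 * m.+1)`!.
Proof.
rewrite mulnS [11 + _]addnC; set a := 11 * m.
rewrite !addnS addn0 !factS !mulnA leq_pmul2r ?fact_gt0 //.
rewrite !expnS expn0 muln1 -[X in _ <= X]mul1n !mulnA mul1n.
set b := a.+4.+4.+3.
have -> : b * a.+4.+4.+2 * a.+4.+4.+1 * a.+4.+4 * a.+4.+3 * a.+4.+2 * a.+4.+1 * a.+4 *
    a.+3 * a.+2 * a.+1 = b * ((a.+4.+4.+2 * a.+4.+4.+1) * (a.+4.+4 * a.+4.+3) * (a.+4.+2 * a.+4.+1) *
    (a.+4 * a.+3) * (a.+2 * a.+1)) by rewrite !mulnA.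
have -> : b * b * b * b * b = b * (b * b * b * b * 1) by rewrite muln1 !mulnA.
by rewrite leq_pmul2l // !leq_mul // /b; nia.
Qed.

(** The valuation and [n %/ 11] only change at multiples of 11, where the
    exponent grows by [5 * (1 + logn 11 m)] while [m] is at least
    [11 ^ logn 11 m]. *)
Lemma logn_fact_bound n : 11 ^ (5 * logn 11 n`!) <= (11 * (n %/ 11))`!.
Proof.
elim: n => [|n IHn]; first by [].
have [/dvdnP[m em]|nd] := boolP (11 %| n.+1).
  have m0 : 0 < m by case: m em.
  have en : n %/ 11 = m.-1 by move: em m0; lia.
  rewrite factS lognM ?fact_gt0 // em mulnK // lognM //.
  have -> : logn 11 11 = 1 by [].
  move: IHn; rewrite en; case: m m0 {em en} => // m _ IHn.
  apply: leq_trans (fact_eleven_step m).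
  rewrite mulnDr expnD leq_mul // mulnC expnM leq_exp2r //.
  by rewrite addn1 expnS leq_mul2l /= dvdn_leq // pfactor_dvdnn.
have -> : n.+1 %/ 11 = n %/ 11 by move: nd; lia.
rewrite factS lognM ?fact_gt0 //.
suff -> : logn 11 n.+1 = 0 by [].
by apply/eqP; rewrite -leqn0 leqNgt logn_gt0 mem_primes /= (negPf nd).
Qed.

Lemma fact_gt_pow_logn n : 11 ^ (5 * logn 11 n`!) <= n`!.
Proof.
by apply: leq_trans (logn_fact_bound n) _; apply: leq_fact; rewrite mulnC leq_trunc_div.
Qed.

(** The orders of the alternating groups are too large compared with their
    11-part: with [q = 11^f] one gets [2 N >= q^5 > 2 (q + 1)^4]. *)
Lemma half_fact_large n f N : 0 < f -> 2 * N = n`! -> 11 ^ f %| N ->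
  (11 ^ f).+1 ^ 4 < N.
Proof.
move=> f0 eN dN; set q := 11 ^ f.
have q11 : 11 <= q by rewrite /q -{1}(expn1 11) leq_exp2l.
have fv : f <= logn 11 n`! by rewrite -pfactor_dvdn ?fact_gt0 // -eN dvdn_mull.
have h : q ^ 5 <= 2 * N.
  rewrite eN /q -expnM mulnC; apply: leq_trans (fact_gt_pow_logn n).
  by rewrite leq_exp2l // leq_mul2l.
suff : 2 * q.+1 ^ 4 < q ^ 5 by lia.
apply: leq_ltn_trans (_ : 2 * (2 * q ^ 2) ^ 2 < _).
  rewrite leq_mul2l /= (expnM q.+1 2 2) leq_exp2r //.
  by rewrite !expnS !expn0; nia.
rewrite (expnS q 4) expnMn -expnM mulnA ltn_pmul2r ?expn_gt0 //; lia.
Qed.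
End Arithmetic.

Section Alternating.
Local Open Scope ring_scope.
Local Open Scope group_scope.
Variable F : finFieldType.

Local Notation G := (PGammaL2_type F).
Local Notation pact := (line_action F).

Lemma rmorph_eq_gen (s : {rmorphism F -> F}) (w : {unit F}) :
  [set: {unit F}] = <[w]> -> s (val w) = val w -> forall x, s x = x.
Proof.
move=> gen sw x; have [->|x0] := eqVneq x 0%R; first exact: rmorph0.
have xU : x \is a GRing.unit by rewrite unitfE.
have : FinRing.unit F xU \in <[w]> by rewrite -gen inE.
by case/cycleP=> i /(congr1 val) /=; rewrite FinRing.val_unitX => ->; rewrite rmorphXn /= sw.
Qed.

(** An element is determined by the images of infinity, 0, 1 and a generator of
    the multiplicative group. This crude bound avoids computing the order of
    PSL_2. *)
Lemma card_PGammaL2 : (#|[set: G]| <= (#|F|.+1) ^ 4)%N.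
Proof.
have /cyclicP[w gen] := field_unit_group_cyclic [set: {unit F}]%G.
pose f (g : G) := (pact None g, pact (Some 0%R) g, pact (Some 1%R) g, pact (Some (val w)) g).
have f_inj : injective f.
  move=> g h [e1 e2 e3 e4]; apply/eqP; rewrite eq_mulgV1; apply/eqP.
  have fixk x : pact x g = pact x h -> pact x (g * h^-1) = x.
    by move=> e; rewrite actM e actK.
  have [s sE] := fix_frame_Some (fixk _ e1) (fixk _ e2) (fixk _ e3).
  have sw : s (val w) = val w by apply: Some_inj; rewrite -sE fixk.
  have sid := rmorph_eq_gen gen sw.
  apply: line_act_inj => -[x|]; first by rewrite sE sid act1.
  by rewrite fixk // act1.
rewrite cardsT -(card_option F) (leq_trans (leq_card f f_inj)) //.
by rewrite !card_prod !expnS expn0 muln1 !mulnA.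
Qed.

Lemma card_dvd_PSL2 : (#|F| %| #|PSL2 F|)%N.
Proof.
rewrite -card_transl; apply: (@cardSg _ (PSL2 F) (transl_group F)).
by apply/subsetP=> _ /imsetP[b _ ->]; exact: transl_PSL2.
Qed.

(** An isomorphism of the socle with [A_n] would give [2 |PSL_2| = n!], although
    [q] divides [|PSL_2|], which is at most [(q + 1)^4]. *)
Lemma not_alternating_standard f (Omega : finType) (to : {action G &-> Omega}) :
  (0 < f)%N -> #|F| = (11 ^ f)%N -> ~ alternating_standard [set: G]%G to.
Proof.
move=> f0 cF [n [pts [ff img _]]].
have F3 : (3 < #|F|)%N by rewrite cF (@leq_trans (11 ^ 1)) ?leq_exp2l.
move: ff img; rewrite (socle_PGammaL2 F3) => ff img.
have cA : #|PSL2 F| = #|'Alt_('I_n)|.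
  rewrite -img morphimEsub ?subsetT // card_in_imset // => x y xS yS /= exy.
  apply/eqP; rewrite eq_mulgV1 -in_set1; apply: (subsetP ff).
  rewrite inE groupM ?groupV //=; apply/astabP=> i _.
  move/permP/(_ i): exy; rewrite !actpermE => exy.
  by rewrite actM exy actK.
have S1 : (1 < #|PSL2 F|)%N by rewrite cardG_gt1 PSL2_neq1.
have n1 : (1 < n)%N.
  rewrite ltnNge; apply/negP=> n1; move: S1; rewrite cA.
  have := subset_leq_card (subsetT 'Alt_('I_n)); rewrite cardsT card_Sn.
  by move=> h /leq_trans/(_ h); case: n n1 {pts ff img cA h} => [|[]].
have := card_Alt (T := 'I_n); rewrite card_ord -cA => /(_ n1) e.
have := half_fact_large f0 e; rewrite -cF => /(_ card_dvd_PSL2).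
by rewrite ltnNge (leq_trans _ card_PGammaL2) // subset_leq_card ?subsetT.
Qed.

End Alternating.

(** * Pair stabilisers are irreducible *)

Section Subspace.

Local Open Scope ring_scope.
Local Open Scope group_scope.
Variable F : finFieldType.

Local Notation G := (PGammaL2_type F).
Local Notation pact := (line_action F).
Local Notation pact2 := (pair_action (line_action F)).

Lemma reducible_fixes_point (M : {set G}) : acts_reducibly M ->
  exists u, forall g, g \in M -> pact u g = u.
Proof.
case=> U [U0 UT stabU]; pose v := vpick U.
have vU : v \in U by exact: memv_pick.
have v0 : v != 0%R by rewrite vpick0.
have eU : <[v]>%VS = U.
  apply/eqP; rewrite eqEdim -memvE vU dim_vline v0 /=.
  rewrite -ltnS; have := dimvS (subvf U); rewrite leq_eqVlt => /orP[/eqP e|].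
    by case/negP: UT; rewrite eqEdim subvf e leqnn.
  by rewrite dimvf /dim /=.
exists (vec_point v) => g gM.
rewrite -{1}[g]lift2K line_actionE ?lift2_GammaL //.
have : lift2 g v \in U by apply: stabU; rewrite ?lift2K ?lift2_GammaL.
rewrite -{1}eU => /vlineP[a ea].
have a0 : a != 0%R.
  apply: contraNneq v0 => a0.
  by rewrite -(GammaL2_eq0 _ (lift2_GammaL g)) ea a0 scale0r.
by rewrite ea vec_pointZ.
Qed.

Hypothesis F_gt3 : (3 < #|F|)%N.

(** The stabiliser of [{oo, 0}] in PSL_2 contains [x |-> c^2 x], whose only fixed
    points are infinity and 0, and [x |-> -1/x], which swaps these two. *)
Lemma pair_stab_fixes_no_point (A : point_pair (option F)) u :
  exists2 g, g \in 'C_[set: G][A | pact2] :&: PSL2 F & pact u g != u.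
Proof.
have [y [z [yz eA]]] := point_pairP A.
have [s sS [sy sz]] := @PSL2_2trans F None (Some 0%R) y z isT yz.
have stab k : k \in PSL2 F ->
  [set pact None k; pact (Some 0%R) k] = [set None; Some 0%R] ->
  k ^ s \in 'C_[set: G][A | pact2] :&: PSL2 F.
  move=> kS ek; rewrite inE PSL2_conj // andbT inE in_setT /=.
  apply/astab1P/val_inj; rewrite val_pair_action eA setact2.
  by rewrite -sy -sz -!actCJ -!(@setact2 _ _ pact _ _ s) ek.
have moved k : pact (pact u s^-1) k != pact u s^-1 -> pact u (k ^ s) != u.
  move=> h; rewrite -{1}(actKV pact s u) -actCJ.
  by apply: contraNneq h => e; rewrite -{2}e actK.
have [c c1] := unit_sqr_neq1 F_gt3.
case eu: (pact u s^-1) moved => [x|] moved; last first.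
  exists (winv F ^ s); last by apply: moved; rewrite winvE.
  by apply: stab; rewrite ?winv_PSL2 // !winvE eqxx setUC.
have [x0|x0] := eqVneq x 0%R.
  exists (winv F ^ s); last by apply: moved; rewrite winvE x0 eqxx.
  by apply: stab; rewrite ?winv_PSL2 // !winvE eqxx setUC.
exists (dilat (c * c) ^ s); last first.
  apply: moved; rewrite dilatE FinRing.val_unitM; apply: contraNneq c1 => -[e].
  by apply/eqP/(mulIf x0); rewrite e mul1r.
by apply: stab; rewrite ?dilat_sqr_PSL2 // !dilatE mulr0.
Qed.

(** A maximal subgroup of the socle above a pair stabiliser fixes no point, hence
    is irreducible; the orthogonal alternative only exists for even [q]. *)
Lemma not_subspace_action : odd #|F| -> ~ subspace_action pact2.
Proof.
move=> oF [_ [A hA]]; rewrite (socle_PGammaL2 F_gt3) in hA.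
have [eS|[M maxM sM]] := maximal_exists (subsetIr 'C_[set: G][A | pact2] (PSL2 F)).
  have [y [z [yz eA]]] := point_pairP A.
  have [w wy wz] := third_point y z.
  have [s sS [sy sz]] := @PSL2_2trans F y z y w yz ltac:(by rewrite eq_sym).
  move: sS; rewrite -eS => /setIP[/setIP[_ /astab1P/(congr1 val)]].
  rewrite val_pair_action eA setact2 sy sz => /setP/(_ w).
  by rewrite !inE eqxx orbT (negPf wy) (negPf wz).
have [/reducible_fixes_point[u fu]|[/negP[]//]] := hA M maxM sM.
have [g gC /eqP[]] := pair_stab_fixes_no_point A u.
exact/fu/(subsetP sM).
Qed.

End Subspace.

(** * Arithmetic of exponents *)

Section Numbers.
Local Open Scope nat_scope.

(** Modulo [p^r - 1], the number [p^m - 1] is [p^b - 1] with [b = m mod r]. *)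
Lemma dvdn_pred_exp_exp p r m : 1 < p -> 0 < r ->
  (p ^ r).-1 %| (p ^ m).-1 -> r %| m.
Proof.
move=> p1 r0.
rewrite {1}(divn_eq m r); set a := m %/ r; set b := m %% r.
have -> : (p ^ (a * r + b)).-1 = p ^ b * ((p ^ r) ^ a).-1 + (p ^ b).-1.
  rewrite expnD (mulnC a) expnM.
  have h : 0 < (p ^ r) ^ a by rewrite !expn_gt0 ltnW.
  have h' : 0 < p ^ b by rewrite expn_gt0 ltnW.
  by nia.
rewrite dvdn_addr ?dvdn_mull ?dvdn_pred_predX //.
have br : b < r by rewrite ltn_mod.
have [b0 _|b0] := posnP b; first by rewrite /dvdn -/b b0.
move=> /dvdn_leq; have : p ^ b < p ^ r by rewrite ltn_exp2l.
have : 1 < p ^ b by rewrite -(expn0 p) ltn_exp2l.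
by move=> ? ? h; exfalso; move: (h ltac:(lia)); lia.
Qed.

Lemma dvdn_prod_primes (s : seq nat) m : uniq s -> all prime s ->
  (forall r, r \in s -> r %| m) -> \prod_(r <- s) r %| m.
Proof.
elim: s => [|r s IHs]; first by rewrite big_nil.
rewrite /= big_cons => /andP[rs us] /andP[pr ps] h.
rewrite Gauss_dvd; first by rewrite h ?mem_head //= IHs // => q qs; rewrite h // inE qs orbT.
rewrite prime_coprime //; apply: contra rs; rewrite Euclid_dvd_prod // big_has.
by case/hasP=> q qs /=; rewrite dvdn_prime2 ?pr ?(allP ps) // => /eqP->.
Qed.

Lemma exists_primes k : exists s : seq nat, [/\ uniq s, all prime s & size s = k].
Proof.
elim: k => [|k [s [us ps sk]]]; first by exists [::].
have [p pm pp] := prime_above (\max_(i <- s) i).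
exists (p :: s); split; rewrite /= ?us ?pp ?ps ?sk // andbT.
apply/negP=> ps'; move: pm; rewrite ltnNge => /negP[].
exact: (@leq_bigmax_seq _ s xpredT id).
Qed.
End Numbers.

(** * Units, subfields and Frobenius maps of a finite field *)

Section Field.

Local Open Scope ring_scope.
Local Open Scope group_scope.
Variables (F : finFieldType) (p f : nat).
Hypotheses (pr_p : prime p) (charF : p \in [pchar F]) (cardF : #|F| = (p ^ f)%N).

Lemma frobenius_iter n :
  exists s : {rmorphism F -> F}, forall x, s x = (x ^+ (p ^ n))%R.
Proof.
elim: n => [|n [s sE]]; first by exists idfun => x; rewrite expr1.
exists (pFrobenius_aut charF \o s) => x /=.
by rewrite sE pFrobenius_autE expnSr exprM.
Qed.

(** Such a unit generates the subfield of order [p^r]; subfields enter the proof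
    only through these units. *)
Lemma exists_unit_order r : (r %| f)%N -> (0 < f)%N ->
  exists a : {unit F}, #[a] = (p ^ r).-1.
Proof.
move=> rf f0; have /cyclicP[w gen] := field_unit_group_cyclic [set: {unit F}]%G.
have ow : #[w] = (p ^ f).-1 by rewrite /order -gen card_finField_unit cardF.
have dv : ((p ^ r).-1 %| (p ^ f).-1)%N.
  by case/dvdnP: rf => k ->; rewrite mulnC expnM dvdn_pred_predX.
exists (w ^+ ((p ^ f).-1 %/ (p ^ r).-1)).
rewrite orderXdiv ow ?dvdn_div //.
have N0 : (0 < (p ^ f).-1)%N by rewrite -ow order_gt0.
by rewrite divnA // mulKn.
Qed.

Lemma frobenius_fix_unit (a : {unit F}) r n : #[a] = (p ^ r).-1 -> (r %| n)%N ->
  (val a ^+ (p ^ n))%R = val a.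
Proof.
move=> oa rn; have pn : (0 < p ^ n)%N by rewrite expn_gt0 prime_gt0.
rewrite -(prednK pn) exprS -FinRing.val_unitX.
suff -> : a ^+ (p ^ n).-1 = 1 by rewrite mulr1.
apply/eqP; rewrite -order_dvdn oa; case/dvdnP: rn => k ->.
by rewrite mulnC expnM dvdn_pred_predX.
Qed.

Section FixedField.
Variable s : {rmorphism F -> F}.
Let K : {set F} := [set x | s x == x].

(** The fixed points form an additive subgroup. *)
Lemma fixed_field_card : exists m, #|K| = (p ^ m)%N.
Proof.
have gK : group_set K.
  apply/group_setP; split=> [|x y]; rewrite !inE ?zmod1gE ?zmodMgE ?rmorph0 //.
  by move=> /eqP ex /eqP ey; rewrite rmorphD ex ey.
have := cardSg (subsetT (Group gK)); rewrite cardsT cardF /=.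
by case/(dvdn_pfactor _ _ pr_p) => m _ e; exists m.
Qed.

Lemma order_dvd_fixed_field (a : {unit F}) : s (val a) = val a ->
  (#[a] %| #|K|.-1)%N.
Proof.
move=> sa; pose KU := [set u : {unit F} | s (val u) == val u].
have gKU : group_set KU.
  apply/group_setP; split=> [|x y]; rewrite !inE ?rmorph1 //.
  by rewrite FinRing.val_unitM rmorphM => /eqP -> /eqP ->.
have -> : #|K|.-1 = #|Group gKU|.
  rewrite (cardsD1 0%R K) inE rmorph0 eqxx /= -(card_imset _ val_inj).
  apply: eq_card => x; rewrite !inE; apply/andP/imsetP=> [[x0 sx]|[u]].
    have xU : x \is a GRing.unit by rewrite unitfE.
    by exists (FinRing.unit F xU); rewrite ?inE.
  by rewrite inE => su ->; rewrite -unitfE (valP u).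
by rewrite order_dvdG // inE sa.
Qed.

(** The fixed field of [s] has [p^m] elements, and by Lagrange's theorem in its
    multiplicative group [p^r - 1] divides [p^m - 1], hence [r] divides [m], for
    each [r]; so [f] divides [m] and [s] fixes everything. *)
Lemma rmorph_id_of_orders (rs : seq nat) (a : nat -> {unit F}) :
  uniq rs -> all prime rs -> f = (\prod_(r <- rs) r)%N ->
  (forall r, r \in rs -> #[a r] = (p ^ r).-1 /\ s (val (a r)) = val (a r)) ->
  forall x, s x = x.
Proof.
move=> urs prs ef ha; have [m Km] := fixed_field_card.
have fm : (f %| m)%N.
  rewrite ef; apply: dvdn_prod_primes => // r rrs; have [oa sa] := ha r rrs.
  apply: (@dvdn_pred_exp_exp p) => //; rewrite ?prime_gt1 //.
    exact/prime_gt0/(allP prs).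
  by rewrite -Km -oa; exact: order_dvd_fixed_field.
have m0 : (0 < m)%N.
  have : (1 < #|K|)%N.
    apply/card_gt1P; exists 0%R, 1%R.
    by rewrite !inE rmorph0 rmorph1 !eqxx eq_sym oner_eq0.
  by rewrite Km; case: m {fm Km}.
have KT : K = [set: F].
  apply/eqP; rewrite eqEcard subsetT cardsT cardF Km leq_exp2l ?prime_gt1 //.
  exact: dvdn_leq.
by move=> x; apply/eqP; have := in_setT x; rewrite -KT inE.
Qed.
End FixedField.

Lemma frobenius_nontrivial (s : {rmorphism F -> F}) n :
  (0 < n < f)%N -> (forall x, s x = (x ^+ (p ^ n))%R) -> exists x, s x <> x.
Proof.
move=> /andP[n0 nf] sE; have f0 : (0 < f)%N by apply: leq_trans nf.
have [w ow] := exists_unit_order (dvdnn f) f0.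
exists (val w); rewrite sE => e; move: nf; rewrite ltnNge => /negP[].
apply: dvdn_leq => //; apply: (@dvdn_pred_exp_exp p); rewrite ?prime_gt1 //.
rewrite -ow order_dvdn; apply/eqP/(mulgI w); rewrite -expgS mulg1 prednK ?expn_gt0 ?prime_gt0 //.
by apply: val_inj; rewrite /= FinRing.val_unitX.
Qed.

End Field.

(** * Large minimal bases *)

Section MinimalSubbase.

Local Open Scope ring_scope.
Local Open Scope group_scope.
Variables (aT : finGroupType) (G : {group aT}) (Omega : finType) (to : {action aT &-> Omega}).

Lemma base_minimal_subseq s : is_base G to s ->
  exists2 t, subseq t s & minimal_base G to t.
Proof.
have [n le_s] := ubnP (size s); elim: n s le_s => // n IHn s le_s bs.
have [ms|nms] := pselect (minimal_base G to s); first by exists s.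
have [t [ts tns bt]] : exists t, [/\ subseq t s, t <> s & is_base G to t].
  apply: contrapT => h; apply: nms; split=> // t ts tns bt.
  by apply: h; exists t.
have [|u ut mu] := IHn t _ bt; last by exists u; first exact: subseq_trans ut ts.
have [le eq] := size_subseq_leqif ts.
rewrite -ltnS; apply: leq_trans le_s; rewrite ltnS ltn_neqAle le eq andbT.
by apply/eqP.
Qed.
End MinimalSubbase.

Section Bases.

Local Open Scope ring_scope.
Local Open Scope group_scope.
Variables (F : finFieldType) (p f : nat).
Hypotheses (pr_p : prime p) (charF : p \in [pchar F]) (cardF : #|F| = (p ^ f)%N).

Local Notation G := (PGammaL2_type F).
Local Notation pact := (line_action F).
Local Notation pact2 := (pair_action (line_action F)).

Lemma infty_pair_key (x : F) : #|[set None; Some x]| == 2.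
Proof. by rewrite cards2. Qed.

Definition infty_pair (x : F) : point_pair (option F) :=
  exist (fun A : {set option F} => #|A| == 2) _ (infty_pair_key x).

Lemma infty_pair_inj : injective infty_pair.
Proof.
move=> x y /(congr1 val)/setP/(_ (Some x)).
by rewrite !inE eqxx => /esym/eqP [].
Qed.

Lemma fix_infty_pair x g : pact None g = None ->
  pact2 (infty_pair x) g = infty_pair x <-> pact (Some x) g = Some x.
Proof.
move=> gN; split=> [/(congr1 val)|e]; last first.
  by apply: val_inj; rewrite val_pair_action setact2 gN e.
rewrite val_pair_action setact2 gN => /setP/(_ (pact (Some x) g)).
rewrite !inE eqxx orbT => /esym/orP[/eqP|/eqP//].
by rewrite -{1}gN => /act_inj.
Qed.

Lemma fix_two_infty_pairs x y g : x != y ->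
  pact2 (infty_pair x) g = infty_pair x -> pact2 (infty_pair y) g = infty_pair y ->
  pact None g = None.
Proof.
move=> xy /(congr1 val) + /(congr1 val); rewrite !val_pair_action !setact2.
move=> /setP/(_ (pact None g)) + /setP/(_ (pact None g)).
rewrite !inE eqxx => /esym/orP[/eqP//|/eqP->] /esym /=.
by rewrite (inj_eq Some_inj) (negPf xy).
Qed.

Variables (rs : seq nat) (a : nat -> {unit F}).
Hypotheses (urs : uniq rs) (prs : all prime rs) (ef : f = (\prod_(r <- rs) r)%N).
Hypothesis oa : forall r, r \in rs -> #[a r] = (p ^ r).-1.

Definition subfield_base : seq (point_pair (option F)) :=
  map infty_pair (0%R :: 1%R :: [seq val (a r) | r <- rs]).

(** The first two pairs force infinity, 0 and 1 to be fixed, so the element is a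
    field automorphism; it fixes a generator of each of the subfields of
    prime degree, and these generate [F]. *)
Lemma subfield_base_is_base : is_base [set: G]%G pact2 subfield_base.
Proof.
apply/trivgP/subsetP=> g /setIP[_ /astabP fg]; rewrite in_set1; apply/eqP.
have fgx x : x \in 0%R :: 1%R :: [seq val (a r) | r <- rs] ->
  pact2 (infty_pair x) g = infty_pair x.
  by move=> xs; apply: fg; rewrite inE; apply: map_f.
have gN : pact None g = None.
  apply: (@fix_two_infty_pairs 0%R 1%R); rewrite ?fgx ?inE ?eqxx ?orbT //.
  by rewrite eq_sym oner_eq0.
have {}fgx x : x \in 0%R :: 1%R :: [seq val (a r) | r <- rs] -> pact (Some x) g = Some x.
  by move/fgx/(fix_infty_pair _ gN).
have [||s sE] := @fix_frame_Some F g gN.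
- by rewrite fgx // inE eqxx.
- by rewrite fgx // !inE eqxx orbT.
have sid := rmorph_id_of_orders pr_p cardF urs prs ef (a := a) (s := s).
apply: line_act_inj => -[x|]; last by rewrite gN act1.
rewrite sE act1 sid // => r rrs; split; first exact: oa.
by apply: Some_inj; rewrite -sE fgx // !inE (map_f (fun r => val (a r)) rrs) !orbT.
Qed.

(** The Frobenius map [x |-> x^(p^(f/r))] fixes the subfields of degree [q] for
    all [q] in [rs] other than [r], and is not trivial: it stabilises all pairs of
    the base but that of [a r]. *)
Lemma subfield_base_needs r t : r \in rs -> subseq t subfield_base ->
  is_base [set: G]%G pact2 t -> infty_pair (val (a r)) \in t.
Proof.
move=> rrs ts bt; apply: contraT => nt.
have [k ek] : exists k, k = (\prod_(q <- rem r rs) q)%N by eexists.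
have erk : f = (r * k)%N by rewrite ef (big_rem _ rrs) ek.
have r1 : (1 < r)%N by apply/prime_gt1/(allP prs).
have k0 : (0 < k)%N.
  by rewrite ek big_seq prodn_cond_gt0 // => q /mem_rem qrs; apply/prime_gt0/(allP prs).
have [s sE] := frobenius_iter charF k.
have [x nx] : exists x, s x <> x.
  apply: (frobenius_nontrivial pr_p cardF _ sE).
  by rewrite k0 erk ltn_Pmull.
have : fieldaut s \in 'C_[set: G]([set A in t] | pact2).
  rewrite inE in_setT; apply/astabP=> A; rewrite inE => At.
  have : A \in subfield_base by exact: mem_subseq ts _ At.
  case/mapP=> y ys eA; move: At; rewrite {}eA => yt.
  apply/fix_infty_pair; rewrite fieldautE //; congr Some.
  move: ys; rewrite !inE => /or3P[/eqP->|/eqP->|/mapP[q qrs ey]].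
  - exact: rmorph0.
  - exact: rmorph1.
  rewrite sE ey (frobenius_fix_unit pr_p (oa qrs)) // ek.
  have qr : q \in rem r rs.
    rewrite mem_rem_uniq // inE qrs andbT.
    by apply: contraNneq nt => <-; rewrite -ey.
  by rewrite (big_rem _ qr) dvdn_mulr.
rewrite bt => /set1P e; case: nx; apply: Some_inj.
by rewrite -(fieldautE s).2 e act1.
Qed.

Lemma large_minimal_base : (size rs <= max_minimal_base [set: G]%G pact2)%N.
Proof.
have [t ts mt] := base_minimal_subseq subfield_base_is_base.
apply: leq_trans (leq_max_minimal_base mt).
rewrite -(size_map (fun r => infty_pair (val (a r)))); apply: uniq_leq_size.
  rewrite map_inj_in_uniq // => q r qrs rrs /infty_pair_inj/val_inj e.
  have := oa qrs; rewrite e (oa rrs) => /(congr1 S).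
  by rewrite !prednK ?expn_gt0 ?prime_gt0 // => /(expnI (prime_gt1 pr_p)) ->.
move=> _ /mapP[r rrs ->]; apply: subfield_base_needs ts _ => //; exact: mt.1.
Qed.

End Bases.

(** * The choice of the field *)

Import Order.TTheory Num.Theory.
Local Open Scope ring_scope.

Theorem lemma6p3 (R : realType) (c : R) (hc : 0 < c) :
  exists (p f : nat) (F : finFieldType),
    [/\ prime p, (0 < f)%N & #|F| = (p ^ f)%N] /\
    exists (Omega : finType) (to : {action PGammaL2_type F &-> Omega}),
      [/\ [primitive [set: PGammaL2_type F], on [set: Omega] | to],
          nonstandard_action to
        & c < (max_minimal_base [set: PGammaL2_type F]%G to)%:R].
Proof.
have [rs [urs prs srs]] := exists_primes (Num.bound c).
pose f := (\prod_(r <- rs) r)%N.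
have f0 : (0 < f)%N.
  by rewrite /f big_seq prodn_cond_gt0 // => q qrs; apply/prime_gt0/(allP prs).
have pr11 : prime 11 by [].
have [F charF cF] := pPrimePowerField pr11 f0.
exists 11%N, f, F; split=> //.
have nz n : ~~ (11 %| n)%N -> (n%:R != 0 :> F) by rewrite (dvdn_pcharf charF).
have F_gt3 : (3 < #|F|)%N by rewrite cF (@leq_trans (11 ^ 1)) ?leq_exp2l.
pose to := pair_action (line_action F); exists (point_pair (option F)), to.
have primP : [primitive [set: PGammaL2_type F], on [set: point_pair (option F)] | to].
  by apply: pairs_primitive; apply: nz.
split=> //.
  split; first exact: PGammaL2_almost_simple.
  case=> _ [|]; first exact: not_alternating_standard f0 cF.
  by apply: not_subspace_action; rewrite // cF oddX orbT.
have /boolp.choice[a oa] : forall r, exists u : {unit F},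
    r \in rs -> #[u]%g = (11 ^ r).-1.
  move=> r.
  have [rrs|] := boolP (r \in rs); last by exists 1%g.
  have rf : (r %| f)%N by rewrite /f (big_rem _ rrs) dvdn_mulr.
  by have [u ou] := exists_unit_order cF rf f0; exists u.
have := large_minimal_base pr11 charF cF urs prs erefl oa.
rewrite srs => le_k; apply: lt_le_trans (archi_boundP (ltW hc)) _.
by rewrite ler_nat.
Qed.
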